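(* The origin has positive $\mathcal H$-capacity, i.e. $\mathrm{Cap}_1(\{0\})>0$.
   Context: $Q_1,Q_2,Q_3,Q_4$ are the four quadrants of $\mathbb R^2$ in anticlockwise order starting from the top-right one, and $B(0,1)$ is the unit disc. Let $a:(0,1]\to[0,\infty]$ be measurable such that: (i) for every $\epsilon>0$ there is $c(\epsilon)>0$ with $a(r)\ge c(\epsilon)$ and $a(r)^{-1}\ge c(\epsilon)$ for all $r\in(\epsilon,1]$; (ii) $\int_0^1 \frac{a(r)}{r}dr<\infty$ and $\int_0^1\frac{r}{a(r)}dr<\infty$; (iii) there is $K>0$ such that $\frac1{\epsilon^2}\int_0^\epsilon \frac{r}{a(r)}\int_0^r\frac{a(s)}{s}\,ds\,dr<K$ for all $\epsilon\in(0,1)$. Let $\rho(x)=a(|x|)^{-1}$ on $(Q_1\cup Q_3)\cap B(0,1)$, $\rho(x)=a(|x|)$ on $(Q_2\cup Q_4)\cap B(0,1)$, $\rho=1$ otherwise, and $\mu(dx)=\rho\,dx$. Then $\rho,\rho^{-1}\in L^1_{\rm loc}(\mathbb R^2)$. Let $\mathcal E(u,v)=\int_{\mathbb R^2}\nabla u\cdot\nabla v\,\rho\,dx$, $\mathcal E_1(u,v)=\mathcal E(u,v)+\langle u,v\rangle_{L^2(\mathbb R^2,\mu)}$, $\mathcal W=\{u\in W^{1,1}_{\rm loc}(\mathbb R^2):\mathcal E_1(u,u)<\infty\}$, and let $\mathcal H$ be the closure of $C_0^\infty(\mathbb R^2)$ (smooth functions with compact support) in $(\mathcal W,\mathcal E_1)$.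 Capacity: for open $A\subset\mathbb R^2$, $\mathrm{Cap}_1(A)=\inf\{\mathcal E_1(u,u):u\in\mathcal H,\ u\ge1\ \mu\text{-a.e. on }A\}$ ($+\infty$ if no such $u$ exists); for general $B\subset\mathbb R^2$, $\mathrm{Cap}_1(B)=\inf\{\mathrm{Cap}_1(A):A\supset B\text{ open}\}$. *)

(* Defs.v *)
From HB Require Import structures.
From mathcomp Require Import all_boot all_order all_algebra.
From mathcomp Require Import all_classical all_reals all_analysis.
From mathcomp Require Import measurable_realfun.

Set Implicit Arguments.
Unset Strict Implicit.
Unset Printing Implicit Defensive.

Import Order.TTheory GRing.Theory Num.Theory.
Import numFieldNormedType.Exports.

Local Open Scope classical_set_scope.
Local Open Scope ring_scope.

(* The type ascription keeps the measurable structure carried by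
   [lebesgue_measure]: the sigma-algebra is the Borel one of R^2. *)
Definition leb2 {R : realType} :
    set (measurableTypeR R * measurableTypeR R) -> \bar R :=
  (@lebesgue_measure R \x @lebesgue_measure R)%E.

(* Euclidean norm; the library norm on R * R is the sup norm. *)
Definition enorm {R : realType} (x : R * R) : R :=
  Num.sqrt (x.1 ^+ 2 + x.2 ^+ 2).

Definition unit_disc {R : realType} : set (R * R) := [set x | enorm x < 1].

(* Open quadrants: the axes are Lebesgue-null, and [a] is never evaluated
   at 0. *)
Definition Q1 {R : realType} : set (R * R) := [set x | 0 < x.1 /\ 0 < x.2].
Definition Q2 {R : realType} : set (R * R) := [set x | x.1 < 0 /\ 0 < x.2].
Definition Q3 {R : realType} : set (R * R) := [set x | x.1 < 0 /\ x.2 < 0].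
Definition Q4 {R : realType} : set (R * R) := [set x | 0 < x.1 /\ x.2 < 0].

(* The inverse on [\bar R] satisfies 0^-1 = +oo and +oo^-1 = 0. *)
Definition weight {R : realType} (a : R -> \bar R) (x : R * R) : \bar R :=
  if x \in (Q1 `|` Q3) `&` unit_disc then ((a (enorm x))^-1)%E
  else if x \in (Q2 `|` Q4) `&` unit_disc then a (enorm x)
  else 1%E.

Definition weighted_measure {R : realType} (rho : R * R -> \bar R)
    (A : set (measurableTypeR R * measurableTypeR R)) : \bar R :=
  (\int[leb2]_(x in A) rho x)%E.

Definition loc_integrable {R : realType} (f : R * R -> R) : Prop :=
  measurable_fun [set: measurableTypeR R * measurableTypeR R] f /\
  forall K : set (R * R), compact K -> (\int[leb2]_(x in K) `|f x|%:E < +oo)%E.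

Definition gradient {R : realType} (f : R * R -> R) (x : R * R) : R * R :=
  ('D_((1, 0) : R * R) f x, 'D_((0, 1) : R * R) f x).

Fixpoint is_Ck {R : realType} (k : nat) (f : R * R -> R) : Prop :=
  continuous f /\
  (if k is k'.+1 then
    [/\ forall x, derivable f x ((1, 0) : R * R),
        forall x, derivable f x ((0, 1) : R * R),
        is_Ck k' (fun x => (gradient f x).1) &
        is_Ck k' (fun x => (gradient f x).2)]
   else True).

(* C_0^oo(R^2): smooth functions with compact support. *)
Definition test_function {R : realType} (f : R * R -> R) : Prop :=
  (forall k, is_Ck k f) /\ compact (closure [set x | f x != 0]).

(* [u] is in W^{1,1}_loc(R^2) with distributional gradient [g].  The gradient
   is determined only Lebesgue-a.e., so elements of W^{1,1}_loc are
   represented below by pairs (u, g). *)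
Definition weak_gradient {R : realType} (u : R * R -> R)
    (g : R * R -> R * R) : Prop :=
  [/\ loc_integrable u,
      loc_integrable (fun x => (g x).1),
      loc_integrable (fun x => (g x).2) &
      forall phi, test_function phi ->
        (\int[leb2]_x (u x * (gradient phi x).1)%:E =
           - \int[leb2]_x ((g x).1 * phi x)%:E)%E /\
        (\int[leb2]_x (u x * (gradient phi x).2)%:E =
           - \int[leb2]_x ((g x).2 * phi x)%:E)%E].

Definition dirichlet_form {R : realType} (rho : R * R -> \bar R)
    (g h : R * R -> R * R) : \bar R :=
  (\int[leb2]_x (((g x).1 * (h x).1 + (g x).2 * (h x).2)%:E * rho x))%E.

Definition form1 {R : realType} (rho : R * R -> \bar R)
    (u : R * R -> R) (g : R * R -> R * R)
    (v : R * R -> R) (h : R * R -> R * R) : \bar R :=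
  (dirichlet_form rho g h + \int[leb2]_x ((u x * v x)%:E * rho x))%E.

Definition energy1 {R : realType} (rho : R * R -> \bar R)
    (u : R * R -> R) (g : R * R -> R * R) : \bar R :=
  form1 rho u g u g.

Definition spaceW {R : realType} (rho : R * R -> \bar R)
    (u : R * R -> R) (g : R * R -> R * R) : Prop :=
  weak_gradient u g /\ (energy1 rho u g < +oo)%E.

Definition spaceH {R : realType} (rho : R * R -> \bar R)
    (u : R * R -> R) (g : R * R -> R * R) : Prop :=
  spaceW rho u g /\
  forall e : R, 0 < e -> exists2 phi, test_function phi &
    (energy1 rho (fun x => (u x - phi x)%R)
                 (fun x => (g x - gradient phi x)%R) < e%:E)%E.

(* The infimum of the empty set in [\bar R] is +oo. *)
Definition cap_open {R : realType} (rho : R * R -> \bar R)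
    (A : set (R * R)) : \bar R :=
  ereal_inf [set c | exists u g,
    [/\ spaceH rho u g,
        negligible (weighted_measure rho) (A `&` [set x | ~ (1 <= u x)]) &
        c = energy1 rho u g]].

Definition Cap1 {R : realType} (rho : R * R -> \bar R)
    (B : set (R * R)) : \bar R :=
  ereal_inf [set cap_open rho A | A in [set A | open A /\ B `<=` A]].

(* Main.v *)
Require Import Defs.
From mathcomp Require Import all_boot all_order all_algebra.
From mathcomp Require Import all_classical all_reals all_analysis.
From mathcomp Require Import measurable_realfun.
From mathcomp Require Import lra ring.

Import Order.TTheory GRing.Theory Num.Theory.
Import numFieldNormedType.Exports.

Local Open Scope classical_set_scope.
Local Open Scope ring_scope.

(** The origin is seen from the sector [0 < y < x] of the first quadrant, where
    the weight is [1 / a(r)] with [r < 1] the distance to it.  So a function [h]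
    of [r] on a ray carries the one-dimensional weight [r / a(r)], and
    [\int a(r) / r dr < +oo] says that the inverse of this weight is integrable
    up to the origin.  By Cauchy-Schwarz, [h] has bounded oscillation on the ray,
    and comparison with its mean over [1/2 < r < 1] yields
    [h(r1)^2 <= M * \int_0^1 (h^2 + h'^2) r / a(r) dr], with [M] independent of
    [r1 <= 1/2] ([point_le_radial_energy]): points are seen by the radial energy.

    Integration over the directions of the sector bounds the square mean of a
    [C^1] function over every arc of radius at most 1/2 by [M] times its energy
    ([arc_trace_le]), and a further integration over [0 < r < d] gives
    [\int phi^2 rho <= M * m * E_1(phi)] on the part of the sector of radius
    less than [d], where [m = \int_0^d r / a(r) dr] is finite and positive
    ([sector_mass_le]).  Both sides are continuous in the norm of [E_1], so an
    element [u] of the closure of the test functions satisfies the same bound up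
    to a numerical factor.  When [u >= 1] almost everywhere on the disc of radius
    [d], the left-hand side is at least [m / 2] ([sector_mass_ge]).  The factor [m]
    cancels, and [E_1(u) >= 1 / (16 M)] ([energy1_ge]) with a bound that does not
    depend on the neighbourhood of the origin.

    Polar coordinates are parametrized by the slope [t] of the ray instead of its
    angle: the change of variables is then a composition of one-dimensional
    dilations with two applications of Tonelli's theorem ([integral_sector]). *)

Local Notation plane R := (measurableTypeR R * measurableTypeR R)%type.

(** * Measurability and iterated integrals *)

(** The integral of a nonnegative function is a supremum over the simple
    functions below it, and enlarging the function or the domain enlarges the
    supremum. *)
Lemma ge0_integral_mono {d} {T : measurableType d} {R : realType}
    (mu : {measure set T -> \bar R}) (D1 D2 : set T) (f1 f2 : T -> \bar R) :
  D1 `<=` D2 -> (forall x, D1 x -> 0 <= f1 x)%E -> (forall x, D2 x -> 0 <= f2 x)%E ->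
  (forall x, D1 x -> f1 x <= f2 x)%E ->
  (\int[mu]_(x in D1) f1 x <= \int[mu]_(x in D2) f2 x)%E.
Proof.
move=> D12 f10 f20 f12; rewrite !ge0_integralE//.
apply: ge_ereal_sup => _ [h /= hf <-]; apply: ereal_sup_ubound; exists h => //= x.
apply: (le_trans (hf x)); rewrite !patchE.
case: ifPn => [|_]; first by rewrite inE => D1x; rewrite mem_set; [exact: f12|exact: D12].
by case: ifPn => //; rewrite inE => /f20.
Qed.

Lemma measurable_funV {d} {T : measurableType d} {R : realType} (f : T -> R) :
  measurable_fun setT f -> (forall x, 0 <= f x) ->
  measurable_fun setT (fun x => (f x)^-1).
Proof.
move=> mf f0; rewrite (_ : (fun _ => _) = (fun x => f x `^ (-1))); last first.
  by apply/funext => x; rewrite powR_inv1.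
exact: (measurableT_comp (measurable_powR _)).
Qed.

Lemma measurable_sqrt {R : realType} : measurable_fun [set: R] (@Num.sqrt R).
Proof. by apply: continuous_measurable_fun; exact: sqrt_continuous. Qed.

(** Continuity refers to the product topology and measurability to the product
    of the Borel sigma-algebras; an open set of the plane is a countable union of
    boxes with rational vertices. *)
Lemma continuous_measurable2 {R : realType} {f : R * R -> R} :
  continuous f ->
  measurable_fun [set: plane R] f.
Proof.
move=> cf; apply: (measurability _ (RGenOpens.measurableE R)).
move=> _ [_ [a [b ->] <-]]; rewrite setTI.
set U := f @^-1` _.
have oU : open U by move/continuousP : cf; apply; exact: interval_open.
pose box (p : rat * rat * rat * rat) : set (plane R) :=
  `]ratr p.1.1.1, ratr p.1.1.2[%classic `*` `]ratr p.1.2, ratr p.2[%classic.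
have -> : U = \bigcup_(p in [set p | box p `<=` U]) box p.
  apply/seteqP; split => [[x y] Uxy|x [p /= pU px]]; last exact: pU.
  have [e /= e0 eU] : exists2 e : R, 0 < e & ball (x, y) e `<=` U.
    by move/nbhs_ballP : (open_nbhs_nbhs (conj oU Uxy)).
  have inb (z : R) : exists p : rat * rat, [/\ ratr p.1 < z, z < ratr p.2 &
      forall w : R, ratr p.1 < w -> w < ratr p.2 -> ball z e w].
    have /rat_in_itvoo[q1] : z - e < z by rewrite gtrBl.
    rewrite in_itv/= => /andP[q11 q12].
    have /rat_in_itvoo[q2] : z < z + e by rewrite ltrDl.
    rewrite in_itv/= => /andP[q21 q22].
    exists (q1, q2); split => // w /= w1 w2.
    by rewrite /ball/= ltr_norml; apply/andP; split; lra.
  have [[p1 p2] [/= xp1 xp2 px]] := inb x; have [[p3 p4] [/= yp1 yp2 py]] := inb y.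
  exists (p1, p2, p3, p4); rewrite /box/=; last by split; rewrite /= in_itv/= ?xp1 ?xp2 ?yp1 ?yp2.
  move=> [x' y'] [/=]; rewrite !in_itv/= => /andP[? ?] /andP[? ?].
  by apply: eU; split; [exact: px|exact: py].
rewrite bigcup_mkcond.
apply: (@countable_bigcupT_measurable _ _ _ _ (@countableP _ _)) => p.
by case: ifP => _ //; apply: measurableX; exact: measurable_itv.
Qed.

Lemma integral_setX_snd {R : realType} (A B : set (measurableTypeR R))
    (k : plane R -> \bar R) t : A t ->
  (\int[@lebesgue_measure R]_(r in B) k (t, r) =
   \int[@lebesgue_measure R]_r (k \_ (A `*` B)) (t, r))%E.
Proof.
move=> At; rewrite [LHS]integral_mkcond; apply: eq_integral => r _; rewrite !patchE.
rewrite (_ : ((t, r) \in _) = (r \in B))//.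
by apply/idP/idP; rewrite !inE => // -[].
Qed.

Lemma integral_setX_fst {R : realType} (A B : set (measurableTypeR R))
    (k : plane R -> \bar R) r : B r ->
  (\int[@lebesgue_measure R]_(t in A) k (t, r) =
   \int[@lebesgue_measure R]_t (k \_ (A `*` B)) (t, r))%E.
Proof.
move=> Br; rewrite [LHS]integral_mkcond; apply: eq_integral => t _; rewrite !patchE.
rewrite (_ : ((t, r) \in _) = (t \in A))//.
by apply/idP/idP; rewrite !inE => // -[].
Qed.

Section iterated_integral.
Context {R : realType} {A B : set (measurableTypeR R)}.
Context {k : plane R -> \bar R}.
Hypotheses (mA : measurable A) (mB : measurable B).
Hypotheses (mk : measurable_fun setT k).
Hypotheses (k0 : forall t r, A t -> B r -> (0 <= k (t, r))%E).

Let mkAB : measurable_fun setT (k \_ (A `*` B)).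
Proof.
by apply/(measurable_restrictT _ (measurableX mA mB)); exact: measurable_funTS.
Qed.

Let kAB0 x : (0 <= (k \_ (A `*` B)) x)%E.
Proof. by apply: erestrict_ge0 => -[t r] [/= At Br]; exact: k0. Qed.

Lemma measurable_integral_snd :
  measurable_fun A (fun t => \int[@lebesgue_measure R]_(r in B) k (t, r))%E.
Proof.
have mF := @measurable_fun_fubini_tonelli_F _ _ _ _ _ (@lebesgue_measure R) _ mkAB kAB0.
apply: (eq_measurable_fun _ _ (measurable_funTS mF)) => t; rewrite inE => At.
by rewrite (integral_setX_snd _ _ _ _ At).
Qed.

Lemma measurable_integral_fst :
  measurable_fun B (fun r => \int[@lebesgue_measure R]_(t in A) k (t, r))%E.
Proof.
have mG := @measurable_fun_fubini_tonelli_G _ _ _ _ _ (@lebesgue_measure R) _ mkAB kAB0.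
apply: (eq_measurable_fun _ _ (measurable_funTS mG)) => t; rewrite inE => At.
by rewrite (integral_setX_fst _ _ _ _ At).
Qed.

Lemma integral_swap :
  (\int[@lebesgue_measure R]_(t in A) \int[@lebesgue_measure R]_(r in B) k (t, r) =
  \int[@lebesgue_measure R]_(r in B) \int[@lebesgue_measure R]_(t in A) k (t, r))%E.
Proof.
transitivity (\int[@lebesgue_measure R]_t \int[@lebesgue_measure R]_r (k \_ (A `*` B)) (t, r))%E.
  rewrite [LHS]integral_mkcond; apply: eq_integral => t _; rewrite patchE.
  case: ifPn => [|]; first by rewrite inE => At; exact: integral_setX_snd.
  rewrite notin_setE => At; rewrite integral0_eq// => r _.
  by rewrite patchE ifF//; apply/negbTE; rewrite notin_setE => -[].
rewrite fubini_tonelli//.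
rewrite [RHS]integral_mkcond; apply: eq_integral => r _; rewrite patchE.
case: ifPn => [|]; first by rewrite inE => Br; exact/esym/integral_setX_fst.
rewrite notin_setE => Br; rewrite integral0_eq// => t _.
by rewrite patchE ifF//; apply/negbTE; rewrite notin_setE => -[].
Qed.
End iterated_integral.

(** * Polar coordinates in a sector *)

Lemma lebesgue_measure_scale {R : realType} {c : R}
    (A : set (measurableTypeR R)) : 0 < c -> measurable A ->
  (lebesgue_measure A = c%:E * @lebesgue_measure R ( *%R c @^-1` A))%E.
Proof.
move=> c0 mA.
have mc : measurable_fun [set: measurableTypeR R]
  ( *%R c : measurableTypeR R -> measurableTypeR R) by exact: measurable_funM.
have := @lebesgue_measure_unique R (mscale (NngNum (ltW c0))
  (pushforward (@lebesgue_measure R)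
    ( *%R c : measurableTypeR R -> measurableTypeR R))).
apply => //= _ [[a b]] _ <-.
rewrite /mscale/= /pushforward/=.
rewrite [X in _ = (_ * lebesgue_measure X)%E]
  (_ : _ = `](c^-1 * a), (c^-1 * b)]%classic); last first.
  by apply/seteqP; split=> x /=; rewrite !in_itv/= ltr_pdivrMl// ler_pdivlMl//.
rewrite !lebesgue_measure_itv/= !lte_fin ltr_pM2l ?invr_gt0//.
case: ifPn => _; last by rewrite mule0.
by rewrite -EFinD -EFinM -mulrBr mulrA divff ?gt_eqF// mul1r EFinB.
Qed.

Lemma ge0_integral_scale {R : realType} {c : R} {f : R -> \bar R} :
  0 < c -> measurable_fun [set: measurableTypeR R] f -> (forall x, 0 <= f x)%E ->
  (\int[@lebesgue_measure R]_x f x =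
   c%:E * \int[@lebesgue_measure R]_x f (c * x)%R)%E.
Proof.
move=> c0 mf f0.
have mc : measurable_fun [set: measurableTypeR R]
    ( *%R c : measurableTypeR R -> measurableTypeR R).
  exact: measurable_funM.
have /esym E := @ge0_integral_pushforward _ _ _ _ R _ mc (@lebesgue_measure R)
  setT f measurableT mf (fun x _ => f0 x).
rewrite preimage_setT in E; rewrite E.
rewrite -(@ge0_integral_mscale _ _ _ _ _ measurableT (NngNum (ltW c0)) _ mf (fun x _ => f0 x)).
by apply: eq_measure_integral => A mA _; exact: lebesgue_measure_scale.
Qed.

Definition sector {R : realType} : set (R * R) := [set x | 0 < x.2 < x.1].

(** The point at distance [r] from the origin on the ray of slope [t]. *)
Definition ray {R : realType} (t r : R) : R * R :=
  (r / Num.sqrt (1 + t ^+ 2), r / Num.sqrt (1 + t ^+ 2) * t).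

Lemma measurable_sector {R : realType} :
  measurable (sector : set (plane R)).
Proof.
rewrite (_ : sector = (fun x : plane R =>
  (0 < x.2) && (x.2 < x.1)) @^-1` [set true]); last by apply/seteqP; split.
rewrite -[X in measurable X]setTI.
have m1 : measurable_fun [set: plane R] (fun x => 0 < x.2).
  by apply: measurable_fun_ltr => //; exact: measurable_snd.
have m2 : measurable_fun [set: plane R] (fun x => x.2 < x.1).
  by apply: measurable_fun_ltr; [exact: measurable_snd|exact: measurable_fst].
exact: (measurable_and m1 m2).
Qed.

Lemma measurable_ray {R : realType} :
  measurable_fun [set: plane R]
    (fun p : plane R =>
       ray p.1 p.2 : plane R).
Proof.
have m1 : measurable_fun [set: plane R]
    (fun p => p.2 / Num.sqrt (1 + p.1 ^+ 2)).
  apply: measurable_funM; first exact: measurable_snd.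
  rewrite (_ : (fun _ => _) = (fun p => (Num.sqrt (1 + p.1 ^+ 2)) `^ (-1))); last first.
    by apply/funext => p; rewrite powR_inv1 ?sqrtr_ge0.
  apply: (measurableT_comp (measurable_powR _)).
  apply: (measurableT_comp measurable_sqrt).
  apply: measurable_funD => //; apply: measurable_funX; exact: measurable_fst.
apply: measurable_fun_pair => //.
by apply: measurable_funM => //; exact: measurable_fst.
Qed.

(** With [y = x t] at fixed [x] and then [x = r / sqrt (1 + t^2)] at fixed
    [t], the area element becomes [r / (1 + t^2) dr dt]. *)
Lemma integral_sector {R : realType} (F : R * R -> \bar R) :
  measurable_fun [set: plane R] F ->
  (forall x, 0 <= F x)%E ->
  (\int[leb2]_(x in sector) F x =
   \int[@lebesgue_measure R]_(t in `]0%R, 1%R[)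
     \int[@lebesgue_measure R]_(r in `]0%R, +oo[)
       ((r / (1 + t ^+ 2))%:E * F (ray t r)))%E.
Proof.
move=> mF F0; rewrite integral_mkcond.
set G := F \_ sector.
have mG : measurable_fun [set: plane R] G.
  by apply/(measurable_restrictT _ measurable_sector); exact: measurable_funTS.
have G0 x : (0 <= G x)%E by apply: erestrict_ge0.
rewrite /leb2 fubini_tonelli1 /fubini_F//.
pose D : set (plane R) := `]0, +oo[%classic `*` `]0, 1[%classic.
have mD : measurable D by apply: measurableX; exact: measurable_itv.
pose H := (fun p : plane R => (p.1%:E * F (p.1, p.1 * p.2)%R)%E) \_ D.
have mH : measurable_fun [set: plane R] H.
  apply/(measurable_restrictT _ mD); apply: measurable_funTS.
  apply: emeasurable_funM; first by apply/measurable_EFinP; exact: measurable_fst.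
  apply: (measurableT_comp mF); apply: measurable_fun_pair; first exact: measurable_fst.
  by apply: measurable_funM; [exact: measurable_fst|exact: measurable_snd].
have H0 x : (0 <= H x)%E.
  apply: erestrict_ge0 => -[x1 x2] [/= + _]; rewrite in_itv/= andbT => x10.
  by rewrite mule_ge0// lee_fin ltW.
transitivity (\int[@lebesgue_measure R]_x \int[@lebesgue_measure R]_y H (x, y))%E.
  apply: eq_integral => x _.
  have [x0|x0] := ltP 0 x.
    have mGx : measurable_fun [set: measurableTypeR R] (fun y => G (x, y)).
      by apply: (measurableT_comp mG); exact: pair1_measurable.
    transitivity (x%:E * \int[@lebesgue_measure R]_y G (x, (x * y)%R))%E.
      exact: (ge0_integral_scale x0 mGx).
    have mx : measurable_fun [set: measurableTypeR R]
        ( *%R x : measurableTypeR R -> measurableTypeR R).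
      exact: measurable_funM.
    rewrite -ge0_integralZl//; [|exact: (measurableT_comp mGx mx)|by rewrite lee_fin ltW].
    apply: eq_integral => y _; rewrite /G /H !patchE.
    rewrite (_ : ((x, x * y) \in sector) = ((x, y) \in D)); last first.
      by apply/idP/idP; rewrite !inE /sector /D/= !in_itv/= andbT pmulr_rgt0// gtr_pMr//; case.
    by case: ifP => // _; rewrite mule0.
  rewrite !integral0_eq// => y _; rewrite /G /H patchE ifF//; apply/negbTE;
    rewrite notin_setE /sector /D/= ?in_itv/=.
    by rewrite ltNge x0; case.
  by move=> /andP[y0 yx]; move: (lt_trans y0 yx); rewrite ltNge x0.
rewrite fubini_tonelli//.
rewrite [RHS]integral_mkcond; apply: eq_integral => t _; rewrite patchE.
case: ifPn; last first.
  rewrite notin_setE => t01; apply: integral0_eq => x _.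
  by rewrite /H patchE ifF//; apply/negbTE; rewrite notin_setE /D/=; case.
rewrite inE/= in_itv/= => /andP[t0 t1].
have s0 : 0 < Num.sqrt (1 + t ^+ 2) by rewrite sqrtr_gt0; nra.
have k0 : 0 < (Num.sqrt (1 + t ^+ 2))^-1 by rewrite invr_gt0.
have mHt : measurable_fun [set: measurableTypeR R] (fun x => H (x, t)).
  by apply: (measurableT_comp mH); exact: pair2_measurable.
rewrite (ge0_integral_scale k0 mHt)//.
have mk : measurable_fun [set: measurableTypeR R]
    ( *%R (Num.sqrt (1 + t ^+ 2))^-1 : measurableTypeR R -> measurableTypeR R).
  exact: measurable_funM.
rewrite -ge0_integralZl//; last exact: (measurableT_comp mHt mk).
rewrite [RHS]integral_mkcond; apply: eq_integral => r _; rewrite /H !patchE.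
rewrite (_ : ((_, t) \in D) = (r \in `]0, +oo[%classic)); last first.
  apply/idP/idP; rewrite !inE /D/= !in_itv/= !andbT pmulr_rgt0//.
    by case.
  by move=> ->; rewrite t0 t1.
case: ifP => // _; last by rewrite mule0.
rewrite /= muleA -EFinM /ray [_ * r]mulrC; congr (_%:E * F _)%E.
by rewrite mulrCA -invfM -expr2 sqr_sqrtr//; nra.
Qed.

Lemma enorm_ray {R : realType} (t r : R) : 0 <= r -> enorm (ray t r) = r.
Proof.
move=> r0; rewrite /enorm /ray/=; set s := Num.sqrt (1 + t ^+ 2).
rewrite (_ : _ + _ = (r / s) ^+ 2 * (1 + t ^+ 2)); last by ring.
have t2 : 0 < 1 + t ^+ 2 by rewrite ltr_pwDl// sqr_ge0.
rewrite exprMn exprVn sqr_sqrtr ?ltW// -mulrA mulVf ?gt_eqF// mulr1.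
by rewrite sqrtr_sqr ger0_norm.
Qed.

Lemma measurable_enorm {R : realType} :
  measurable_fun [set: plane R] (@enorm R).
Proof.
apply: (measurableT_comp measurable_sqrt).
apply: measurable_funD; apply: measurable_funX; [exact: measurable_fst|exact: measurable_snd].
Qed.

Lemma measurable_radial {R : realType} (q : R -> R) :
  measurable_fun [set: measurableTypeR R] q ->
  measurable_fun [set: plane R] (q \o enorm).
Proof. by move=> mq; exact: (measurableT_comp mq measurable_enorm). Qed.

Lemma measurable_oneDsqrV {R : realType} :
  measurable_fun [set: measurableTypeR R] (fun t => (1 + t ^+ 2)^-1).
Proof. exact: (continuous_measurable_fun continuous_oneDsqrV). Qed.

Lemma measurable_sector_density {R : realType} (F : R * R -> R) :
  measurable_fun [set: plane R] F ->
  measurable_fun [set: plane R]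
    (fun p => (p.2 / (1 + p.1 ^+ 2))%:E * (F (ray p.1 p.2))%:E)%E.
Proof.
move=> mF; apply: emeasurable_funM; apply/measurable_EFinP.
  apply: measurable_funM; first exact: measurable_snd.
  exact: (measurableT_comp measurable_oneDsqrV measurable_fst).
exact: (measurableT_comp mF measurable_ray).
Qed.

(** Bounds on arcs integrate to a bound on the sector: in polar coordinates the
    weight factors out of the integral over the slope. *)
Lemma sector_mass_le {R : realType} {q : R -> R} {phi : R * R -> R} {T : \bar R} :
  measurable_fun [set: plane R] phi ->
  measurable_fun [set: measurableTypeR R] q -> (forall r, 0 <= q r) -> (0 <= T)%E ->
  (forall r, 0 < r -> q r != 0 ->
    (\int[@lebesgue_measure R]_(t in `]0%R, 1%R[)
       ((1 + t ^+ 2)^-1 * (phi (ray t r)) ^+ 2)%:E <= T)%E) ->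
  (\int[leb2]_(x in sector) ((phi x) ^+ 2 * q (enorm x))%:E <=
    (\int[@lebesgue_measure R]_(r in `]0%R, +oo[) (r * q r)%:E) * T)%E.
Proof.
move=> mphi mq q0 T0 HT.
pose F x := (phi x) ^+ 2 * q (enorm x).
have F0 x : 0 <= F x by rewrite mulr_ge0 ?sqr_ge0.
have mF : measurable_fun [set: plane R] F.
  by apply: measurable_funM; [exact: measurable_funX|exact: measurable_radial].
rewrite (integral_sector (fun x => (F x)%:E))//; last exact/measurable_EFinP.
have mD := measurable_sector_density _ mF.
have mI : measurable (`]0, 1[%classic : set (measurableTypeR R)) by exact: measurable_itv.
have mJ : measurable (`]0, +oo[%classic : set (measurableTypeR R)) by exact: measurable_itv.
have t2 (t : R) : 0 < 1 + t ^+ 2 by rewrite ltr_pwDl// sqr_ge0.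
have k0 (t r : R) : `]0, 1[%classic t -> `]0, +oo[%classic r ->
    (0 <= (r / (1 + t ^+ 2))%:E * (F (ray t r))%:E)%E.
  by move=> _; rewrite /= in_itv/= andbT => r0; rewrite -EFinM lee_fin mulr_ge0// divr_ge0 ?ltW.
rewrite (integral_swap mI mJ mD k0).
have mrq : measurable_fun [set: measurableTypeR R] (fun r => r * q r) by exact: measurable_funM.
rewrite -ge0_integralZr//; first last.
- by move=> r /=; rewrite in_itv/= andbT => r0; rewrite lee_fin mulr_ge0// ltW.
- by apply/measurable_EFinP; exact: measurable_funTS.
apply: ge0_le_integral => //.
- by move=> r rJ; apply: integral_ge0 => t tI; exact: k0.
- exact: (measurable_integral_fst mI mJ mD k0).
- by apply: emeasurable_funM => //; apply/measurable_EFinP; exact: measurable_funTS.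
move=> r /=; rewrite in_itv/= andbT => r0.
have [q_0|qn0] := eqVneq (q r) 0.
  rewrite q_0 mulr0 mul0e integral0_eq// => t _.
  by rewrite /F enorm_ray ?(ltW r0)// q_0 mulr0 mule0.
rewrite (_ : (\int[_]_(_ in _) _)%E = ((r * q r)%:E *
  \int[@lebesgue_measure R]_(t in `]0%R, 1%R[)
     ((1 + t ^+ 2)^-1 * (phi (ray t r)) ^+ 2)%:E)%E).
  by apply: lee_wpmul2l; [rewrite lee_fin mulr_ge0// ltW|exact: HT].
rewrite -ge0_integralZl//.
- apply: eq_integral => t _; rewrite -!EFinM /F enorm_ray ?(ltW r0)//.
  by congr EFin; ring.
- apply/measurable_EFinP; apply: measurable_funTS; apply: measurable_funM.
    exact: measurable_oneDsqrV.
  apply: measurable_funX; apply: (measurableT_comp mphi).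
  exact: (measurableT_comp measurable_ray (pair2_measurable (r : measurableTypeR R))).
- by move=> t _; rewrite lee_fin mulr_ge0 ?sqr_ge0// invr_ge0 ltW.
- by rewrite lee_fin mulr_ge0// ltW.
Qed.

(** [1 / (1 + t^2) >= 1/2] for slopes [0 < t < 1]. *)
Lemma sector_mass_ge {R : realType} {q : R -> R} :
  measurable_fun [set: measurableTypeR R] q -> (forall r, 0 <= q r) ->
  ((2^-1)%:E * (\int[@lebesgue_measure R]_(r in `]0%R, +oo[) (r * q r)%:E) <=
   \int[leb2]_(x in sector) (q (enorm x))%:E)%E.
Proof.
move=> mq q0.
pose F (x : R * R) := q (enorm x).
have mF : measurable_fun [set: plane R] F by exact: measurable_radial.
rewrite (integral_sector (fun x => (F x)%:E))//; first last.
- by move=> x; rewrite lee_fin; exact: q0.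
- exact/measurable_EFinP.
have mD := measurable_sector_density _ mF.
have mI : measurable (`]0, 1[%classic : set (measurableTypeR R)) by exact: measurable_itv.
have mJ : measurable (`]0, +oo[%classic : set (measurableTypeR R)) by exact: measurable_itv.
have t2 (t : R) : 0 < 1 + t ^+ 2 by rewrite ltr_pwDl// sqr_ge0.
have k0 (t r : R) : `]0, 1[%classic t -> `]0, +oo[%classic r ->
    (0 <= (r / (1 + t ^+ 2))%:E * (F (ray t r))%:E)%E.
  move=> _; rewrite /= in_itv/= andbT => r0; rewrite -EFinM lee_fin mulr_ge0//; last exact: q0.
  by rewrite divr_ge0 ?ltW.
have mrq : measurable_fun [set: measurableTypeR R] (fun r => r * q r) by exact: measurable_funM.
rewrite -ge0_integralZl//; first last.
- by move=> r /=; rewrite in_itv/= andbT => r0; rewrite lee_fin mulr_ge0// ltW.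
- by apply/measurable_EFinP; exact: measurable_funTS.
set m := (X in (X <= _)%E).
have -> : m = (\int[@lebesgue_measure R]_(t in `]0%R, 1%R[) m)%E.
  rewrite integral_cst//=; have -> := lebesgue_measure_itv (`]0, 1[ : interval R).
  by rewrite /= lte_fin ltr01 oppr0 adde0 mule1.
have hrq (r : R) : `]0, +oo[%classic r -> (0 <= (2^-1)%:E * (r * q r)%:E)%E.
  by rewrite /= in_itv/= andbT => r0; rewrite -EFinM lee_fin mulr_ge0// mulr_ge0// ltW.
have m0 : (0 <= m)%E by exact: integral_ge0.
apply: ge0_le_integral => //.
- exact: (measurable_integral_snd mI mJ mD k0).
move=> t /=; rewrite in_itv/= => /andP[t0 t1].
apply: ge0_le_integral => //.
- by apply: measurable_funeM; apply/measurable_EFinP; exact: measurable_funTS.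
- exact: (measurable_funTS (measurableT_comp mD (pair1_measurable (t : measurableTypeR R)))).
move=> r /=; rewrite in_itv/= andbT => r0; rewrite -!EFinM lee_fin /F enorm_ray ?(ltW r0)//.
rewrite mulrA ler_wpM2r// mulrC ler_wpM2l ?(ltW r0)//.
by rewrite lef_pV2 ?posrE//; nra.
Qed.

Lemma radial_mass_gt0 {R : realType} {q : R -> R} {d : R} :
  measurable_fun [set: measurableTypeR R] q -> (forall r, 0 < r < d -> 0 < q r) ->
  0 < d -> (0 < \int[@lebesgue_measure R]_(r in `]0%R, d[) (r * q r)%:E)%E.
Proof.
move=> mq q1 d0.
have f0 (r : R) : `]0, d[%classic r -> 0 < r * q r.
  by rewrite /= in_itv/= => rd; rewrite mulr_gt0// ?q1//; case/andP: rd.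
have mf : measurable_fun (`]0, d[%classic : set (measurableTypeR R)) (fun r => (r * q r)%:E).
  by apply/measurable_EFinP; apply: measurable_funTS; exact: measurable_funM.
rewrite lt_neqAle; apply/andP; split; last first.
  by apply: integral_ge0 => r rI; rewrite lee_fin ltW// f0.
apply/eqP => /esym I0.
have mI : measurable (`]0, d[%classic : set (measurableTypeR R)) by exact: measurable_itv.
have : (\int[@lebesgue_measure R]_(r in `]0%R, d[) `|(r * q r)%:E| = 0)%E.
  rewrite -[RHS]I0; apply: eq_integral => r; rewrite inE => rI.
  by rewrite gee0_abs// lee_fin ltW// f0.
move/(ae_eq_integral_abs _ mI mf) => [B [mB B0 IB]].
have : (@lebesgue_measure R `]0%R, d[%classic <= lebesgue_measure B)%E.
  apply: le_measure; rewrite ?inE// => r rI; apply: IB => /= /(_ rI) [] /eqP.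
  by rewrite gt_eqF// f0.
rewrite B0; have -> := lebesgue_measure_itv (`]0, d[ : interval R).
by rewrite /= lte_fin d0 oppr0 adde0 lee_fin leNgt d0.
Qed.

(** * Chain rule along rays *)

(** A mean value theorem insensitive to the order of the endpoints. *)
Lemma mean_value {R : realType} (f df : R -> R) (x y : R) :
  (forall z : R, is_derive z 1 f (df z)) ->
  exists2 c, `|c - x| <= `|y - x| & f y - f x = df c * (y - x).
Proof.
move=> Df.
have cf : continuous f.
  move=> z; apply: differentiable_continuous; apply/derivable1_diffP.
  by have [] := Df z.
have [xy|yx|->] := ltgtP x y; last first.
- by exists y => //; rewrite !subrr mulr0.
- have [c] := @MVT R f df y x yx (fun z _ => Df z) (continuous_subspaceT cf).
  rewrite in_itv/= => /andP[yc cx] E; exists c.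
    by rewrite !ltr0_norm ?subr_lt0// lerN2 lerB// ltW.
  by rewrite -opprB E; ring.
- have [c] := @MVT R f df x y xy (fun z _ => Df z) (continuous_subspaceT cf).
  rewrite in_itv/= => /andP[xc cy] E; exists c => //.
  by rewrite !gtr0_norm ?subr_gt0// lerB// ltW.
Qed.

Lemma is_derive_fst {R : realType} (phi : R * R -> R) (x y : R) :
  derivable phi (x, y) ((1, 0) : R * R) ->
  is_derive x 1 (fun s : R => phi (s, y)) (gradient phi (x, y)).1.
Proof.
move=> D.
have E : (fun h : R => h^-1 *: ((phi \o shift (x, y)) (h *: ((1, 0) : R * R)) - phi (x, y))) =
    (fun h : R => h^-1 *: (((fun s : R => phi (s, y)) \o shift x) (h *: (1 : R)) - phi (x, y))).
  apply/funext => h /=; congr (_ *: (phi _ - _)).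
  by congr pair; rewrite /= ?scaler0 ?add0r.
by apply: DeriveDef; rewrite /gradient/= /derivable /derive/= -E.
Qed.

Lemma is_derive_snd {R : realType} (phi : R * R -> R) (x y : R) :
  derivable phi (x, y) ((0, 1) : R * R) ->
  is_derive y 1 (fun s : R => phi (x, s)) (gradient phi (x, y)).2.
Proof.
move=> D.
have E : (fun h : R => h^-1 *: ((phi \o shift (x, y)) (h *: ((0, 1) : R * R)) - phi (x, y))) =
    (fun h : R => h^-1 *: (((fun s : R => phi (x, s)) \o shift y) (h *: (1 : R)) - phi (x, y))).
  apply/funext => h /=; congr (_ *: (phi _ - _)).
  by congr pair; rewrite /= ?scaler0 ?add0r.
by apply: DeriveDef; rewrite /gradient/= /derivable /derive/= -E.
Qed.

(** Continuous partial derivatives give the chain rule along a line through the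
    origin: an increment is split into a horizontal and a vertical one, to each of
    which the one-variable mean value theorem applies. *)
Lemma is_derive_line {R : realType} (phi : R * R -> R) (v : R * R) (r : R) :
  is_Ck 1 phi ->
  is_derive r 1 (fun s : R => phi (s * v.1, s * v.2))
    (v.1 * (gradient phi (r * v.1, r * v.2)).1 + v.2 * (gradient phi (r * v.1, r * v.2)).2).
Proof.
case=> cphi [D1 D2 [c1 _] [c2 _]].
set X := r * v.1; set Y := r * v.2.
set L := (X in is_derive _ _ _ X).
suff H : h^-1 *: (phi ((h *: 1 + r) * v.1, (h *: 1 + r) * v.2) - phi (X, Y)) @[h --> (0:R)^'] --> L.
  apply: DeriveDef; first by apply/cvg_ex; exists L.
  by apply/cvg_lim.
apply/cvgrPdist_le => /= e e0.
pose N := `|v.1| + `|v.2| + 1.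
have N0 : 0 < N by rewrite ltr_wpDl// addr_ge0.
have eN : 0 < e / N by rewrite divr_gt0.
have /cvgrPdist_le/(_ _ eN)/nbhs_ballP[d1 /= d10 B1] := c1 (X, Y).
have /cvgrPdist_le/(_ _ eN)/nbhs_ballP[d2 /= d20 B2] := c2 (X, Y).
near=> h.
have hn0 : h != 0 by near: h; exact: nbhs_dnbhs_neq.
have hd1 : `|h| * N < d1.
  by rewrite -ltr_pdivlMr//; near: h; apply: dnbhs0_lt; rewrite divr_gt0.
have hd2 : `|h| * N < d2.
  by rewrite -ltr_pdivlMr//; near: h; apply: dnbhs0_lt; rewrite divr_gt0.
rewrite !scaler1.
have [c cX E1] := @mean_value R _ _ X ((h + r) * v.1)
  (fun z => is_derive_fst _ _ ((h + r) * v.2) (D1 (z, (h + r) * v.2))).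
have [c' cY E2] := @mean_value R _ _ Y ((h + r) * v.2)
  (fun z => is_derive_snd _ _ _ (D2 (X, z))).
rewrite (_ : phi _ - phi _ =
  (phi ((h + r) * v.1, (h + r) * v.2) - phi (X, (h + r) * v.2)) +
  (phi (X, (h + r) * v.2) - phi (X, Y))); last by ring.
rewrite E1 E2.
have dX : (h + r) * v.1 - X = h * v.1 by rewrite /X; ring.
have dY : (h + r) * v.2 - Y = h * v.2 by rewrite /Y; ring.
rewrite dX dY in cX cY *.
rewrite (_ : L - _ = v.1 * ((gradient phi (X, Y)).1 - (gradient phi (c, (h + r) * v.2)).1) +
   v.2 * ((gradient phi (X, Y)).2 - (gradient phi (X, c')).2)); last first.
  rewrite /L /GRing.scale/=; field.
  done.
have v1N : `|h * v.1| <= `|h| * N by rewrite normrM ler_wpM2l// /N -addrA lerDl addr_ge0.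
have v2N : `|h * v.2| <= `|h| * N.
  by rewrite normrM ler_wpM2l// /N [_ + `|v.2|]addrC -addrA lerDl addr_ge0.
have b1 : `|(gradient phi (X, Y)).1 - (gradient phi (c, (h + r) * v.2)).1| <= e / N.
  apply: B1; split; rewrite /ball/= distrC.
    by rewrite (le_lt_trans cX)// (le_lt_trans v1N).
  by rewrite dY (le_lt_trans v2N).
have b2 : `|(gradient phi (X, Y)).2 - (gradient phi (X, c')).2| <= e / N.
  apply: B2; split; rewrite /ball/= distrC ?subrr ?normr0//.
  by rewrite (le_lt_trans cY)// (le_lt_trans v2N).
rewrite (le_trans (ler_normD _ _))// !normrM.
rewrite (@le_trans _ _ (`|v.1| * (e / N) + `|v.2| * (e / N)))//.
  by rewrite lerD// ler_wpM2l.
rewrite -mulrDl mulrCA ger_pMr//.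
by rewrite ler_pdivrMr// mul1r lerDl.
Unshelve. all: by end_near. Qed.

(** * Energy in the sector *)

(** The part of the energy carried by the sector, for a radial weight [q]. *)
Definition sector_energy {R : realType} (q : R -> R) (u : R * R -> R)
    (g : R * R -> R * R) : \bar R :=
  (\int[leb2]_(x in sector)
     (((u x) ^+ 2 + ((g x).1 ^+ 2 + (g x).2 ^+ 2)) * q (enorm x))%:E)%E.

Lemma sector_energy_le {R : realType} {q : R -> R} {rho : R * R -> \bar R}
    {u : R * R -> R} {g : R * R -> R * R} :
  measurable_fun [set: measurableTypeR R] q -> (forall r, 0 <= q r) ->
  measurable_fun [set: plane R] u ->
  measurable_fun [set: plane R] (fun x => (g x).1) ->
  measurable_fun [set: plane R] (fun x => (g x).2) ->
  (forall x, 0 <= rho x)%E -> (forall x, sector x -> ((q (enorm x))%:E <= rho x)%E) ->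
  (sector_energy q u g <= energy1 rho u g)%E.
Proof.
move=> mq q0 mu mg1 mg2 rho0 qrho.
have mqe := measurable_radial _ mq.
have q0' x : 0 <= q (enorm x) by exact: q0.
have mg : measurable_fun [set: plane R]
    (fun x => ((g x).1 ^+ 2 + (g x).2 ^+ 2) * q (enorm x)).
  by apply: measurable_funM => //; apply: measurable_funD; exact: measurable_funX.
have mu2 : measurable_fun [set: plane R]
    (fun x => (u x) ^+ 2 * q (enorm x)).
  by apply: measurable_funM => //; exact: measurable_funX.
rewrite /sector_energy /energy1 /form1 /dirichlet_form.
under eq_integral do rewrite addrC mulrDl EFinD.
rewrite ge0_integralD//; first last.
- by apply/measurable_EFinP; exact: measurable_funTS.
- by move=> x _; rewrite lee_fin mulr_ge0 ?sqr_ge0.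
- by apply/measurable_EFinP; exact: measurable_funTS.
- by move=> x _; rewrite lee_fin mulr_ge0 ?addr_ge0 ?sqr_ge0.
- exact: measurable_sector.
apply: leeD; apply: ge0_integral_mono => //.
- by move=> x _; rewrite lee_fin mulr_ge0 ?addr_ge0 ?sqr_ge0.
- by move=> x _; rewrite mule_ge0// lee_fin -!expr2 addr_ge0 ?sqr_ge0.
- move=> x Vx; rewrite EFinM -!expr2; apply: lee_wpmul2l; last exact: qrho.
  by rewrite lee_fin addr_ge0 ?sqr_ge0.
- by move=> x _; rewrite lee_fin mulr_ge0 ?sqr_ge0.
- by move=> x _; rewrite mule_ge0// lee_fin -!expr2 sqr_ge0.
- move=> x Vx; rewrite EFinM -!expr2; apply: lee_wpmul2l; last exact: qrho.
  by rewrite lee_fin sqr_ge0.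
Qed.

(** Pointwise, [b^2 <= 2 a^2 + 2 (a - b)^2]. *)
Lemma sector_energy_triangle {R : realType} {q : R -> R}
    {u phi : R * R -> R} {g gphi : R * R -> R * R} :
  measurable_fun [set: measurableTypeR R] q -> (forall r, 0 <= q r) ->
  measurable_fun [set: plane R] u ->
  measurable_fun [set: plane R] phi ->
  measurable_fun [set: plane R] (fun x => (g x).1) ->
  measurable_fun [set: plane R] (fun x => (g x).2) ->
  measurable_fun [set: plane R] (fun x => (gphi x).1) ->
  measurable_fun [set: plane R] (fun x => (gphi x).2) ->
  (sector_energy q phi gphi <= 2%:E * sector_energy q u g +
   2%:E * sector_energy q (fun x => (u x - phi x)%R) (fun x => (g x - gphi x)%R))%E.
Proof.
move=> mq q0 mu mphi mg1 mg2 mh1 mh2.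
have mqe := measurable_radial _ mq.
have q0' x : 0 <= q (enorm x) by exact: q0.
have mE (v : R * R -> R) (k : R * R -> R * R) :
  measurable_fun [set: plane R] v ->
  measurable_fun [set: plane R] (fun x => (k x).1) ->
  measurable_fun [set: plane R] (fun x => (k x).2) ->
  measurable_fun [set: plane R]
    (fun x => ((v x) ^+ 2 + ((k x).1 ^+ 2 + (k x).2 ^+ 2)) * q (enorm x)).
  move=> mv mk1 mk2; apply: measurable_funM => //.
  by apply: measurable_funD; [|apply: measurable_funD]; exact: measurable_funX.
have E0 (v : R * R -> R) (k : R * R -> R * R) x :
    (0 <= (((v x) ^+ 2 + ((k x).1 ^+ 2 + (k x).2 ^+ 2)) * q (enorm x))%:E)%E.
  by rewrite lee_fin mulr_ge0 ?addr_ge0 ?sqr_ge0.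
have mV := @measurable_sector R.
have md : measurable_fun [set: plane R]
    (fun x => ((u x - phi x) ^+ 2 + ((g x - gphi x).1 ^+ 2 + (g x - gphi x).2 ^+ 2)) * q (enorm x)).
  by apply: (mE (fun x => u x - phi x) (fun x => g x - gphi x)); exact: measurable_funB.
rewrite /sector_energy.
rewrite -ge0_integralZl//; last first.
- by apply/measurable_EFinP; apply: measurable_funTS; exact: mE.
rewrite -ge0_integralZl//; last first.
- by move=> x _; exact: (E0 (fun x => u x - phi x) (fun x => g x - gphi x)).
- by apply/measurable_EFinP; exact: measurable_funTS.
rewrite -ge0_integralD//; first last.
- by apply: measurable_funeM; apply/measurable_EFinP; exact: measurable_funTS.
- by move=> x _; rewrite mule_ge0//; exact: (E0 (fun x => u x - phi x) (fun x => g x - gphi x)).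
- by apply: measurable_funeM; apply/measurable_EFinP; apply: measurable_funTS; exact: mE.
- by move=> x _; rewrite mule_ge0.
apply: ge0_integral_mono => //.
- by move=> x _; rewrite adde_ge0// mule_ge0//;
    exact: (E0 (fun x => u x - phi x) (fun x => g x - gphi x)).
move=> x _; rewrite -!EFinM -EFinD lee_fin /=.
rewrite !mulrA -mulrDl ler_wpM2r//.
have sq (a b : R) : b ^+ 2 <= 2 * a ^+ 2 + 2 * (a - b) ^+ 2.
  rewrite -subr_ge0 (_ : _ - _ = (2 * a - b) ^+ 2); first exact: sqr_ge0.
  by ring.
have := sq (u x) (phi x); have := sq (g x).1 (gphi x).1; have := sq (g x).2 (gphi x).2.
lra.
Qed.

(** * Radial weights seeing the origin *)

(** The optimal scale in the bound of [oscillation_le] is [l = S / d]. *)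
Lemma sqr_le_of_forall_scale {R : realType} (d S z : R) : 0 <= d -> 0 < S -> 0 <= z ->
  (forall l, 0 < l -> d <= (l * z + S / l) / 2) -> d ^+ 2 <= S * z.
Proof.
move=> d0 S0 z0 H; have [->|dn0] := eqVneq d 0; first by rewrite expr0n/= mulr_ge0// ltW.
have dp : 0 < d by rewrite lt_neqAle eq_sym dn0.
have := H (S / d) (divr_gt0 S0 dp).
rewrite invf_div (_ : S * (d / S) = d); last by field; rewrite gt_eqF.
rewrite ler_pdivlMr// -lerBlDr.
rewrite (_ : S / d * z = (S * z) / d); last by ring.
by rewrite ler_pdivlMr// => ?; nra.
Qed.

(** Here [q] is the reciprocal of [a]: [S] bounds [\int a(r) / r dr] and [1 / C]
    bounds the weight from below on [1/2 < r < 1]. *)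
Section radial_weight.
Context {R : realType} {q : R -> R} {S C : R}.
Hypotheses (mq : measurable_fun [set: measurableTypeR R] q)
  (q0 : forall r, 0 <= q r) (q1 : forall r, 0 < r < 1 -> 0 < q r).
Hypotheses (S0 : 0 < S)
  (HS : (\int[@lebesgue_measure R]_(r in `]0%R, 1%R[) ((q r)^-1 / r)%:E
         <= S%:E)%E).
Hypotheses (C0 : 0 < C) (HC : forall r, 2^-1 < r < 1 -> 1 <= C * q r).

Let M0 : 0 < 8 * C + 2 * S.
Proof. by rewrite addr_gt0// mulr_gt0. Qed.

(** A form of Cauchy-Schwarz linear in the integrals: pointwise,
    [|h'| <= (l h'^2 w + 1 / (l w)) / 2] with [w = q(r) r]. *)
Lemma oscillation_le {h dh : R -> R} {l z r1 r2 : R} :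
  (forall r : R, is_derive r 1 h (dh r)) -> continuous dh ->
  (\int[@lebesgue_measure R]_(r in `]0%R, 1%R[)
     (((h r) ^+ 2 + (dh r) ^+ 2) * (q r * r))%:E <= z%:E)%E ->
  0 < r1 -> r1 < r2 -> r2 < 1 -> 0 < l ->
  `|h r2 - h r1| <= (l * z + S / l) / 2.
Proof.
move=> Dh cdh Hz r10 r12 r21 l0.
have mdh : measurable_fun [set: measurableTypeR R] dh by exact: continuous_measurable_fun.
have dh1 r : derivable h r 1 by have [] := Dh r.
have ch : continuous h.
  by move=> r; apply: differentiable_continuous; apply/derivable1_diffP.
have mh : measurable_fun [set: measurableTypeR R] h by exact: continuous_measurable_fun.
have mqV : measurable_fun [set: measurableTypeR R] (fun r => (q r)^-1) by exact: measurable_funV.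
have me : measurable_fun [set: measurableTypeR R] (fun r => ((h r) ^+ 2 + (dh r) ^+ 2) * (q r * r)).
  apply: measurable_funM; first by apply: measurable_funD; exact: measurable_funX.
  exact: measurable_funM.
have mp : measurable_fun (`]0, 1[%classic : set (measurableTypeR R)) (fun r => (q r)^-1 / r).
  apply: measurable_funM; first exact: measurable_funTS.
  apply: (eq_measurable_fun (fun r => r `^ (-1))).
    by move=> r; rewrite inE/= in_itv/= => /andP[r0 _]; rewrite powR_inv1// ltW.
  apply: measurable_funTS; exact: measurable_powR.
have FTC : (\int[@lebesgue_measure R]_(r in `[r1, r2]) (dh r)%:E = (h r2)%:E - (h r1)%:E)%E.
  apply: continuous_FTC2 => //.
  - exact: continuous_subspaceT.
  - split => //.
    + by apply: cvg_at_right_filter; exact: ch.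
    + by apply: cvg_at_left_filter; exact: ch.
  - by move=> r _; rewrite derive1E; have [_ ->] := Dh r.
rewrite -lee_fin -abse_EFin EFinB -FTC.
apply: (le_trans (le_abse_integral _ _ _)) => //.
  by apply/measurable_EFinP; exact: measurable_funTS.
have mI : measurable (`]0, 1[%classic : set (measurableTypeR R)) by exact: measurable_itv.
apply: (@le_trans _ _ (\int[@lebesgue_measure R]_(r in `]0%R, 1%R[)
   ((l / 2)%:E * (((h r) ^+ 2 + (dh r) ^+ 2) * (q r * r))%:E + ((l^-1 / 2)%:E * ((q r)^-1 / r)%:E))))%E.
  apply: (@le_trans _ _ (\int[@lebesgue_measure R]_(r in `]0%R, 1%R[) `|(dh r)%:E|))%E.
    apply: ge0_subset_integral => //.
      by apply/measurable_EFinP; apply: measurable_funTS; apply: measurableT_comp.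
    move=> r /=; rewrite !in_itv/= => /andP[? ?]; apply/andP; split; lra.
  apply: ge0_le_integral => //.
  - by apply/measurable_EFinP; apply: measurable_funTS; apply: measurableT_comp.
  - apply: emeasurable_funD; apply: measurable_funeM; apply/measurable_EFinP => //.
    exact: measurable_funTS.
  - move=> r /=; rewrite in_itv/= => r01.
    have qr := q1 _ r01; case/andP: r01 => r0 _.
    rewrite -!EFinM -EFinD lee_fin.
    set w := q r * r; have -> : (q r)^-1 / r = w^-1 by rewrite -invfM.
    have w0 : 0 < w by rewrite mulr_gt0.
    have lw : 0 < l * w by rewrite mulr_gt0.
    have E : (l * w) * (l * w)^-1 = 1 by rewrite divff ?gt_eqF.
    rewrite (_ : l^-1 / 2 * w^-1 = (l * w)^-1 / 2); last by rewrite (invfM l w); ring.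
    have n2 : `|dh r| ^+ 2 = dh r ^+ 2 by rewrite real_normK ?num_real.
    have v0 : 0 < (l * w)^-1 by rewrite invr_gt0.
    (* The square of [sqrt (l w) |h'| - 1 / sqrt (l w)], written without roots. *)
    have : 0 <= (l * w * `|dh r| - 1) ^+ 2 * (l * w)^-1 by rewrite mulr_ge0 ?sqr_ge0// ltW.
    have -> : (l * w * `|dh r| - 1) ^+ 2 * (l * w)^-1 =
        (l * w) * `|dh r| ^+ 2 - 2 * `|dh r| + (l * w)^-1.
      rewrite (_ : _ * _ = (l * w) * (l * w)^-1 *
        (l * w * `|dh r| ^+ 2 - 2 * `|dh r|) + (l * w)^-1); last by ring.
      by rewrite E mul1r.
    rewrite n2; have : 0 <= l * w * h r ^+ 2 by rewrite mulr_ge0 ?sqr_ge0// ltW.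
    by move: ((l * w)^-1) => v; nra.
rewrite ge0_integralD//; first last.
- by apply: measurable_funeM; exact/measurable_EFinP.
- move=> r /=; rewrite in_itv/= => /andP[r0 _]; rewrite -EFinM lee_fin !mulr_ge0// ?invr_ge0// ?ltW//.
- by apply: measurable_funeM; apply/measurable_EFinP; exact: measurable_funTS.
- move=> r /=; rewrite in_itv/= => /andP[r0 _]; rewrite -EFinM lee_fin mulr_ge0//; first by lra.
  by rewrite mulr_ge0 ?addr_ge0 ?sqr_ge0// mulr_ge0// ltW.
rewrite !ge0_integralZl_EFin//; first last.
- by lra.
- by apply/measurable_EFinP; exact: measurable_funTS.
- move=> r /=; rewrite in_itv/= => /andP[r0 _]; rewrite lee_fin.
  by rewrite mulr_ge0 ?addr_ge0 ?sqr_ge0// mulr_ge0// ltW.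
- by rewrite mulr_ge0 ?invr_ge0// ltW.
- exact/measurable_EFinP.
- by move=> r /=; rewrite in_itv/= => /andP[r0 _]; rewrite lee_fin !mulr_ge0// ?invr_ge0// ?ltW//.
rewrite (_ : ((l * z + S / l) / 2)%:E = ((l / 2)%:E * z%:E + (l^-1 / 2)%:E * S%:E)%E); last first.
  by rewrite -!EFinM -EFinD; congr EFin; ring.
by apply: leeD; apply: lee_wpmul2l => //; rewrite lee_fin ?divr_ge0// ?invr_ge0 ltW.
Qed.

(** For [r] in [1/2 < r < 1], [h(r1)^2 <= 2 h(r)^2 + 2 (h(r) - h(r1))^2]; the
    second term is controlled by the oscillation bound, and the mean over [r] of
    the first one by the weighted square integral, the weight being bounded
    below there. *)
Lemma point_le_radial_energy {h dh : R -> R} {r1 : R} :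
  (forall r : R, is_derive r 1 h (dh r)) -> continuous dh ->
  0 < r1 <= 2^-1 ->
  (((h r1) ^+ 2)%:E <= (8 * C + 2 * S)%:E *
     \int[@lebesgue_measure R]_(r in `]0%R, 1%R[)
        (((h r) ^+ 2 + (dh r) ^+ 2) * (q r * r))%:E)%E.
Proof.
move=> Dh cdh /andP[r10 r12].
set Z := (X in (_ <= _ * X)%E).
have e0 r : r \in `]0, 1[%classic -> 0 <= ((h r) ^+ 2 + (dh r) ^+ 2) * (q r * r).
  by rewrite inE/= in_itv/= => /andP[? ?]; rewrite mulr_ge0 ?addr_ge0 ?sqr_ge0// mulr_ge0// ltW.
have Z0 : (0 <= Z)%E by apply: integral_ge0 => r /mem_set rI; rewrite lee_fin e0.
have C4 : 0 <= 4 * C by rewrite mulr_ge0// ltW.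
have : (Z < +oo \/ Z = +oo)%E by case: ltP; [left|right; apply/eqP; rewrite -leye_eq].
case => [Zoo|->]; last by rewrite gt0_muley ?lte_fin// leey.
have /fineK Zz : Z \is a fin_num by rewrite ge0_fin_numE.
set z := fine Z in Zz.
have z0 : 0 <= z by rewrite fine_ge0.
have Sz0 : 0 <= S * z by rewrite mulr_ge0// ltW.
have mdh : measurable_fun [set: measurableTypeR R] dh by exact: continuous_measurable_fun.
have dh1 r : derivable h r 1 by have [] := Dh r.
have ch : continuous h.
  by move=> r; apply: differentiable_continuous; apply/derivable1_diffP.
have mh : measurable_fun [set: measurableTypeR R] h by exact: continuous_measurable_fun.
have me : measurable_fun [set: measurableTypeR R] (fun r => ((h r) ^+ 2 + (dh r) ^+ 2) * (q r * r)).
  apply: measurable_funM; first by apply: measurable_funD; exact: measurable_funX.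
  exact: measurable_funM.
have K r : 2^-1 < r < 1 -> (h r1) ^+ 2 <=
    4 * C * (((h r) ^+ 2 + (dh r) ^+ 2) * (q r * r)) + 2 * (S * z).
  move=> /andP[r2 r21].
  have osc : `|h r - h r1| ^+ 2 <= S * z.
    apply: sqr_le_of_forall_scale => // l l0.
    by apply: (oscillation_le Dh cdh) => //; rewrite -/Z ?Zz//; lra.
  have w1 : 1 <= 2 * C * (q r * r).
    have := HC r; rewrite r2 r21 => /(_ isT) ?.
    have : 0 <= (C * q r - 1) * r + (r - 2^-1) by rewrite addr_ge0// ?mulr_ge0//; lra.
    by lra.
  rewrite real_normK ?num_real// in osc.
  have : 0 <= (2 * C * (q r * r) - 1) * (h r ^+ 2 + dh r ^+ 2).
    by rewrite mulr_ge0 ?subr_ge0// addr_ge0 ?sqr_ge0.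
  have : 0 <= dh r ^+ 2 by exact: sqr_ge0.
  have : 0 <= (h r + (h r - h r1)) ^+ 2 by exact: sqr_ge0.
  by lra.
have mJ : measurable (`]2^-1, 1[%classic : set (measurableTypeR R)) by exact: measurable_itv.
have half k : (\int[@lebesgue_measure R]_(r in `]2^-1%R, 1%R[) k%:E = (k / 2)%:E)%E.
  rewrite integral_cst//=; have -> := lebesgue_measure_itv (`]2^-1, 1[ : interval R).
  rewrite /= lte_fin ifT; last by lra.
  by rewrite -EFinB -EFinM; congr EFin; lra.
have : (\int[@lebesgue_measure R]_(r in `]2^-1%R, 1%R[) ((h r1) ^+ 2)%:E <=
        \int[@lebesgue_measure R]_(r in `]2^-1%R, 1%R[)
    ((4 * C)%:E * (((h r) ^+ 2 + (dh r) ^+ 2) * (q r * r))%:E + (2 * (S * z))%:E))%E.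
  apply: ge0_le_integral => //.
  - by move=> r _; rewrite lee_fin sqr_ge0.
  - apply: emeasurable_funD => //; apply: measurable_funeM; apply/measurable_EFinP.
    exact: measurable_funTS.
rewrite half => /le_trans => /(_ ((4 * C)%:E * Z + (2 * (S * z) / 2)%:E))%E.
rewrite -Zz -!EFinM -EFinD !lee_fin => H.
suff K2 : h r1 ^+ 2 / 2 <= 4 * C * z + 2 * (S * z) / 2 by lra.
apply: H; rewrite ge0_integralD//; first last.
- by move=> r _; rewrite lee_fin mulr_ge0.
- by apply: measurable_funeM; apply/measurable_EFinP; exact: measurable_funTS.
- move=> r /=; rewrite in_itv/= => /andP[? ?]; rewrite -EFinM lee_fin mulr_ge0//.
  by apply: e0; rewrite inE/= in_itv/=; apply/andP; split; lra.
rewrite half EFinD leeD2r// (EFinM (4 * C) z) Zz /Z ge0_integralZl_EFin//; first last.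
- by apply/measurable_EFinP; exact: measurable_funTS.
- move=> r /=; rewrite in_itv/= => /andP[? ?]; rewrite lee_fin.
  by apply: e0; rewrite inE/= in_itv/=; apply/andP; split; lra.
apply: lee_wpmul2l; first by rewrite lee_fin.
apply: ge0_subset_integral => //.
- by apply/measurable_EFinP; exact: measurable_funTS.
- by move=> r rI; rewrite lee_fin e0// inE.
- by move=> r /=; rewrite !in_itv/= => /andP[? ?]; apply/andP; split; lra.
Qed.

(** Apply the one-dimensional estimate on each ray, where the derivative along
    the ray is at most the length of the gradient. *)
Lemma arc_trace_le {phi : R * R -> R} {r1 : R} :
  is_Ck 1 phi ->
  0 < r1 <= 2^-1 ->
  (\int[@lebesgue_measure R]_(t in `]0%R, 1%R[) ((1 + t ^+ 2)^-1 * (phi (ray t r1)) ^+ 2)%:E <=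
   (8 * C + 2 * S)%:E * sector_energy q phi (gradient phi))%E.
Proof.
move=> Cphi r1I.
have [cphi [_ _ [c1 _] [c2 _]]] := Cphi.
have mphi := continuous_measurable2 cphi.
have m1 := continuous_measurable2 c1.
have m2 := continuous_measurable2 c2.
pose F x := ((phi x) ^+ 2 + ((gradient phi x).1 ^+ 2 + (gradient phi x).2 ^+ 2)) * q (enorm x).
have F0 x : 0 <= F x by rewrite mulr_ge0 ?addr_ge0 ?sqr_ge0.
have mF : measurable_fun [set: plane R] F.
  apply: measurable_funM; last exact: measurable_radial.
  by apply: measurable_funD; [|apply: measurable_funD]; exact: measurable_funX.
rewrite /sector_energy (integral_sector (fun x => (F x)%:E))//; last exact/measurable_EFinP.
have mD := measurable_sector_density _ mF.
have mI : measurable (`]0, 1[%classic : set (measurableTypeR R)) by exact: measurable_itv.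
have mJ : measurable (`]0, +oo[%classic : set (measurableTypeR R)) by exact: measurable_itv.
have t2 (t : R) : 0 < 1 + t ^+ 2 by rewrite ltr_pwDl// sqr_ge0.
have k0 (t r : R) : `]0, 1[%classic t -> `]0, +oo[%classic r ->
    (0 <= (r / (1 + t ^+ 2))%:E * (F (ray t r))%:E)%E.
  by move=> _; rewrite /= in_itv/= andbT => r0; rewrite -EFinM lee_fin mulr_ge0// divr_ge0 ?ltW.
have mS := measurable_integral_snd mI mJ mD k0.
rewrite -ge0_integralZl//; first last.
- by rewrite lee_fin ltW.
- by move=> t tI; apply: integral_ge0 => r rJ; exact: k0.
apply: ge0_le_integral => //.
- by move=> t _; rewrite lee_fin mulr_ge0 ?invr_ge0 ?sqr_ge0// ltW.
- apply/measurable_EFinP; apply: measurable_funTS; apply: measurable_funM.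
    exact: measurable_oneDsqrV.
  apply: measurable_funX; apply: (measurableT_comp mphi).
  exact: (measurableT_comp measurable_ray (pair2_measurable (r1 : measurableTypeR R))).
- by apply: measurable_funeM.
move=> t tI.
pose v : R * R := ((Num.sqrt (1 + t ^+ 2))^-1, (Num.sqrt (1 + t ^+ 2))^-1 * t).
have rayE r : ray t r = (r * v.1, r * v.2) by rewrite /ray /v/= mulrA.
pose h r := phi (r * v.1, r * v.2).
pose dh r := v.1 * (gradient phi (r * v.1, r * v.2)).1 + v.2 * (gradient phi (r * v.1, r * v.2)).2.
have Dh (r : R) : is_derive r 1 h (dh r) by exact: is_derive_line.
have cline : continuous (fun r : R => (r * v.1, r * v.2)).
  by move=> r; apply: (@cvg_pair _ _ _ _ (nbhs (r * v.1)) (nbhs (r * v.2)));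
    (apply: cvgM; [exact: cvg_id|exact: cvg_cst]).
have cd1 : continuous (fun r : R => (gradient phi (r * v.1, r * v.2)).1).
  by move=> r; exact: (@continuous_comp _ _ _ _ (fun x => (gradient phi x).1) r (cline r) (c1 _)).
have cd2 : continuous (fun r : R => (gradient phi (r * v.1, r * v.2)).2).
  by move=> r; exact: (@continuous_comp _ _ _ _ (fun x => (gradient phi x).2) r (cline r) (c2 _)).
have cdh : continuous dh.
  by move=> r; apply: cvgD; (apply: cvgM; [exact: cvg_cst|]); [exact: cd1|exact: cd2].
have := point_le_radial_energy Dh cdh r1I.
have v1 : v.1 ^+ 2 + v.2 ^+ 2 = 1.
  rewrite /v/= exprMn exprVn sqr_sqrtr ?ltW//; field.
  by rewrite gt_eqF.
move=> /(lee_wpmul2l (_ : 0 <= ((1 + t ^+ 2)^-1)%:E)%E).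
rewrite lee_fin invr_ge0 ltW// => /(_ isT).
rewrite -EFinM {1}/h -rayE => /le_trans; apply.
rewrite muleCA; apply: lee_wpmul2l; first by rewrite lee_fin ltW.
have mh : measurable_fun [set: measurableTypeR R] h.
  apply: (eq_measurable_fun (fun r => phi (ray t r))); first by move=> r _; rewrite rayE.
  apply: (measurableT_comp mphi).
  exact: (measurableT_comp measurable_ray (pair1_measurable (t : measurableTypeR R))).
have mdh : measurable_fun [set: measurableTypeR R] dh by exact: continuous_measurable_fun.
have mE : measurable_fun [set: measurableTypeR R] (fun r => (h r ^+ 2 + dh r ^+ 2) * (q r * r)).
  apply: measurable_funM; first by apply: measurable_funD; exact: measurable_funX.
  exact: measurable_funM.
have mDt := measurableT_comp mD (pair1_measurable (t : measurableTypeR R)).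
rewrite -ge0_integralZl//; first last.
- by rewrite lee_fin invr_ge0 ltW.
- move=> r /=; rewrite in_itv/= => /andP[r0 _]; rewrite lee_fin.
  by rewrite mulr_ge0 ?addr_ge0 ?sqr_ge0// mulr_ge0// ltW.
- by apply/measurable_EFinP; exact: measurable_funTS.
apply: (@le_trans _ _ (\int[@lebesgue_measure R]_(r in `]0%R, 1%R[)
   ((r / (1 + t ^+ 2))%:E * (F (ray t r))%:E)))%E.
  apply: ge0_le_integral => //.
  - move=> r /=; rewrite in_itv/= => /andP[r0 _]; rewrite -EFinM lee_fin.
    by rewrite mulr_ge0 ?invr_ge0 ?(ltW (t2 _))// mulr_ge0 ?addr_ge0 ?sqr_ge0// mulr_ge0// ltW.
  - by apply: measurable_funeM; apply/measurable_EFinP; exact: measurable_funTS.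
  - exact: (measurable_funTS mDt).
  move=> r /=; rewrite in_itv/= => /andP[r0 _]; rewrite -!EFinM lee_fin.
  rewrite /F enorm_ray ?(ltW r0)// rayE.
  rewrite (_ : r / _ * _ = (1 + t ^+ 2)^-1 * (((phi (r * v.1, r * v.2)) ^+ 2 +
    ((gradient phi (r * v.1, r * v.2)).1 ^+ 2 +
     (gradient phi (r * v.1, r * v.2)).2 ^+ 2)) * (q r * r))); last by ring.
  rewrite ler_wpM2l ?invr_ge0 ?(ltW (t2 _))// ler_wpM2r ?mulr_ge0 ?(ltW r0)// lerD2l /dh.
  set a := (gradient _ _).1; set b := (gradient _ _).2.
  rewrite -[leRHS]mul1r -v1 -subr_ge0.
  by rewrite (_ : _ - _ = (v.1 * b - v.2 * a) ^+ 2) ?sqr_ge0//; ring.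
apply: ge0_subset_integral => //.
- exact: (measurable_funTS mDt).
- by move=> r rJ; exact: k0.
- by move=> r /=; rewrite !in_itv/= andbT => /andP[].
Qed.

(** The constant is independent of [A].  The weight is truncated to a disc of
    radius [d] contained in [A], and [u] is replaced by a test function at a
    distance in energy which is small compared with the mass [m] of the truncated
    weight. *)
Lemma energy1_ge {rho : R * R -> \bar R}
    {A : set (R * R)} {u : R * R -> R} {g : R * R -> R * R} :
  (\int[@lebesgue_measure R]_(r in `]0%R, 1%R[) (r * q r)%:E < +oo)%E ->
  (forall x, 0 <= rho x)%E -> (forall x, sector x -> ((q (enorm x))%:E <= rho x)%E) ->
  open A -> A (0, 0) ->
  spaceH rho u g ->
  negligible (weighted_measure rho) (A `&` [set x | ~ (1 <= u x)]) ->
  (((16 * (8 * C + 2 * S))^-1)%:E <= energy1 rho u g)%E.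
Proof.
move=> Hm rho0 qrho oA A0 [[[[mu _] [mg1 _] [mg2 _] _] Eoo] Happ] [B [mB B0 AB]].
have := M0; set M := 8 * C + 2 * S => Mp.
have [d /andP[d0 d1] dA] : exists2 d : R, 0 < d <= 2^-1 & forall x, enorm x < d -> A x.
  have /nbhs_ballP[e /= e0 eA] := open_nbhs_nbhs (conj oA A0).
  exists (Num.min e 2^-1).
    by apply/andP; split; [rewrite lt_min e0 invr_gt0 ltr0n|rewrite ge_min lexx orbT].
  move=> [x y]; rewrite lt_min => /andP[xe _]; apply: eA.
  have sq0 : 0 <= x ^+ 2 + y ^+ 2 by rewrite addr_ge0 ?sqr_ge0.
  have nx : `|x| <= enorm (x, y).
    by rewrite /enorm/= -sqrtr_sqr ler_sqrt// lerDl sqr_ge0.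
  have ny : `|y| <= enorm (x, y).
    by rewrite /enorm/= -sqrtr_sqr ler_sqrt// lerDr sqr_ge0.
  by split; rewrite /ball/= sub0r normrN (le_lt_trans _ xe).
pose qd : R -> R := q \* \1_(`]0, d[%classic : set (measurableTypeR R)).
have mqd : measurable_fun [set: measurableTypeR R] qd.
  apply: measurable_funM => //; apply: measurable_indic; exact: measurable_itv.
have qdE r : qd r = if 0 < r < d then q r else 0.
  rewrite /qd/= indicE; case: ifPn => rd.
    by rewrite mem_set ?mulr1//= in_itv.
  by rewrite memNset ?mulr0//= in_itv; exact/negP.
have qd0 r : 0 <= qd r by rewrite qdE; case: ifP.
have qdq r : qd r <= q r by rewrite qdE; case: ifP.
set m' := (\int[@lebesgue_measure R]_(r in `]0%R, +oo[) (r * qd r)%:E)%E.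
have m'E : m' = (\int[@lebesgue_measure R]_(r in `]0%R, d[) (r * q r)%:E)%E.
  rewrite /m' [LHS]integral_mkcond [RHS]integral_mkcond; apply: eq_integral => r _.
  rewrite !patchE qdE.
  rewrite (_ : (r \in `]0, d[%classic) = (0 < r < d)); last first.
    by apply/idP/idP; rewrite inE/= in_itv.
  have [rd|rd] := ifPn (0 < r < d).
    by rewrite mem_set//= in_itv/= andbT; case/andP: rd.
  by rewrite mulr0; case: ifP.
have m'0 : (0 < m')%E.
  rewrite m'E; apply: radial_mass_gt0 => // r /andP[r0 rd]; apply: q1; lra.
have m'oo : (m' < +oo)%E.
  apply: le_lt_trans Hm; rewrite m'E; apply: ge0_integral_mono => //.
  - by move=> r /=; rewrite !in_itv/= => /andP[r0 rd]; apply/andP; split; lra.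
  - by move=> r /=; rewrite !in_itv/= => /andP[r0 rd]; rewrite lee_fin mulr_ge0// ltW.
  - by move=> r /=; rewrite !in_itv/= => /andP[r0 rd]; rewrite lee_fin mulr_ge0// ltW.
have [m mE] : exists m, m' = m%:E.
  by exists (fine m'); rewrite fineK// ge0_fin_numE// ltW.
have m0 : 0 < m by rewrite -lte_fin -mE.
have Mm0 : 0 < M * m by rewrite mulr_gt0.
(* The approximation costs [(4 M m + 2) e] in the comparison of [umass] with [low]
   below, and [e] makes this cost half of the lower bound [m / 2]. *)
pose e := (m / 4) / (4 * (M * m) + 2).
have e0 : 0 < e by rewrite divr_gt0//; lra.
have [phi [Cphi _] Hphi] := Happ e e0.
have C1 := Cphi 1%N.
have [cphi [_ _ [c1 _] [c2 _]]] := C1.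
have mphi := continuous_measurable2 cphi.
have m1 := continuous_measurable2 c1.
have m2 := continuous_measurable2 c2.
have mup : measurable_fun [set: plane R] (fun x => u x - phi x).
  exact: measurable_funB.
pose Eu := sector_energy q u g.
pose Ed := sector_energy q (fun x => u x - phi x) (fun x => g x - gradient phi x).
have Eu_le : (Eu <= energy1 rho u g)%E by exact: sector_energy_le.
have Ed_le : (Ed < e%:E)%E.
  by apply: le_lt_trans Hphi; apply: sector_energy_le => //; exact: measurable_funB.
have mqde := measurable_radial _ mqd.
have mV := @measurable_sector R.
have Ege0 (p : R -> R) v k : (forall r, 0 <= p r) -> (0 <= sector_energy p v k :> \bar R)%E.
  move=> p0; apply: integral_ge0 => x _; rewrite lee_fin mulr_ge0//.
  by rewrite !addr_ge0 ?sqr_ge0.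
have [eu euE] : exists v, Eu = v%:E.
  by exists (fine Eu); rewrite fineK// ge0_fin_numE ?Ege0// (le_lt_trans Eu_le).
have [ed edE] : exists v, Ed = v%:E.
  by exists (fine Ed); rewrite fineK// ge0_fin_numE ?Ege0// (lt_trans Ed_le) ?ltry.
have Ephi : (sector_energy q phi (gradient phi) <= (2 * eu + 2 * ed)%:E)%E.
  rewrite EFinD !EFinM -euE -edE; exact: sector_energy_triangle.
(* With a zero gradient, [sector_energy] is a weighted square integral. *)
pose Z (x : R * R) : R * R := (0, 0).
have trace : (sector_energy qd phi Z <= (m * (M * (2 * eu + 2 * ed)))%:E)%E.
  rewrite EFinM -mE /sector_energy.
  under eq_integral do rewrite /= expr0n/= !addr0.
  apply: sector_mass_le => //.
    rewrite lee_fin mulr_ge0 ?(ltW Mp)// -lee_fin; apply: le_trans Ephi; exact: Ege0.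
  move=> r r0; rewrite qdE; case: ifPn => [/andP[_ rd] _|]; last by rewrite eqxx.
  apply: (le_trans (arc_trace_le C1 _)); first by apply/andP; split; lra.
  by rewrite EFinM; apply: lee_wpmul2l => //; rewrite lee_fin ltW.
have dist : (sector_energy qd (fun x => (phi x - u x)%R) (fun x => (Z x - Z x)%R) <= ed%:E)%E.
  rewrite -edE; apply: ge0_integral_mono => //.
  - by move=> x _; rewrite lee_fin mulr_ge0// !addr_ge0 ?sqr_ge0.
  - by move=> x _; rewrite lee_fin mulr_ge0// !addr_ge0 ?sqr_ge0.
  - move=> x _; rewrite lee_fin; apply: ler_pM => //; first by rewrite !addr_ge0 ?sqr_ge0.
    rewrite /= subrr expr0n/= !addr0 -(sqrrN (phi x - u x)) opprB lerDl.
    by rewrite addr_ge0 ?sqr_ge0.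
have umass : (sector_energy qd u Z <= (2 * (m * (M * (2 * eu + 2 * ed))) + 2 * ed)%:E)%E.
  apply: (le_trans (@sector_energy_triangle _ _ phi _ Z _ mqd qd0 _ _ _ _ _ _)) => //.
  by rewrite [leRHS]EFinD; apply: leeD; rewrite [leRHS]EFinM; apply: lee_wpmul2l.
(* [u < 1] holds inside the disc only on the set [B], which is null for [rho],
   hence for the smaller weight [qd]. *)
have low : ((m / 2)%:E <= sector_energy qd u Z)%E.
  rewrite mulrC EFinM -mE; apply: (le_trans (sector_mass_ge mqd qd0)).
  have mVB : measurable (sector `&` B) by exact: measurableI.
  have mVDB : measurable (sector `\` B) by exact: measurableD.
  rewrite -[X in (\int[_]_(_ in X) _)%E](setUIDK sector B) ge0_integral_setU//; last 3 first.
  - by rewrite setUIDK; apply/measurable_EFinP; exact: measurable_funTS.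
  - by move=> x _; rewrite lee_fin.
  - by apply/disj_setPLR => x [_ Bx] [].
  have VB0 : (\int[leb2]_(x in sector `&` B) (qd (enorm x))%:E = 0)%E.
    apply/eqP; rewrite eq_le; apply/andP; split; last first.
      by apply: integral_ge0 => x _; rewrite lee_fin.
    rewrite -B0; apply: ge0_integral_mono => //.
    - by move=> x _; rewrite lee_fin.
    - by move=> x [Vx _]; apply: le_trans (qrho _ Vx); rewrite lee_fin.
  rewrite VB0 add0e; apply: ge0_integral_mono => //.
  - by move=> x _; rewrite lee_fin.
  - by move=> x _; rewrite lee_fin mulr_ge0// !addr_ge0 ?sqr_ge0.
  move=> x [Vx nBx]; rewrite lee_fin /= expr0n/= !addr0.
  have [->|qn0] := eqVneq (qd (enorm x)) 0; first by rewrite mulr0.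
  rewrite ler_peMl//.
  have xd : enorm x < d by move: qn0; rewrite qdE; case: ifPn => [/andP[]//|]; rewrite eqxx.
  have [u1|u1] := leP 1 (u x); first nra.
  exfalso; apply: nBx; apply: AB; split; first exact: dA.
  by move=> /= u1'; move: u1; rewrite ltNge u1'.
have := le_trans low umass; rewrite lee_fin => H.
apply: le_trans Eu_le; rewrite euE lee_fin.
move: Ed_le; rewrite edE lte_fin => ed_e.
have : (4 * (M * m) + 2) * e = m / 4.
  by rewrite /e; field; rewrite gt_eqF//; lra.
have -> : (16 * M)^-1 = 16^-1 * M^-1 by rewrite invfM.
rewrite ler_pdivrMr//.
move=> e1.
have : (4 * (M * m) + 2) * ed <= m / 4 by rewrite -e1 ler_pM2l ?ltW//; lra.
move=> e2.
have : 0 <= m * (4 * (M * eu) - 4^-1) by lra.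
by rewrite pmulr_rge0//; lra.
Qed.

End radial_weight.

(** * Positive capacity of the origin *)

Theorem lemma3p12 (R : realType) (a : R -> \bar R)
  (a_ge0 : forall r : R, 0 < r -> r <= 1 -> (0 <= a r)%E)
  (a_meas : measurable_fun (`]0%R, 1%R] : set (measurableTypeR R)) a)
  (a_bounds : forall e : R, 0 < e -> exists c : R, 0 < c /\
     forall r : R, e < r -> r <= 1 -> (c%:E <= a r)%E /\ (c%:E <= (a r)^-1)%E)
  (a_int : (\int[@lebesgue_measure R]_(r in `]0%R, 1%R]) (a r * (r^-1)%:E)
            < +oo)%E)
  (ainv_int : (\int[@lebesgue_measure R]_(r in `]0%R, 1%R]) (r%:E * (a r)^-1)
               < +oo)%E)
  (a_K : exists K : R, 0 < K /\ forall e : R, 0 < e -> e < 1 ->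
     (((e ^+ 2)^-1)%:E *
        \int[@lebesgue_measure R]_(r in `]0%R, e])
          (r%:E * (a r)^-1 *
             \int[@lebesgue_measure R]_(s in `]0%R, r]) (a s * (s^-1)%:E))
      < K%:E)%E) :
  (0 < Cap1 (weight a) [set (0%R, 0%R)])%E.
Proof.
have aE r : 0 < r -> r <= 1 -> a r = (fine (a r))%:E /\ 0 < fine (a r).
  move=> r0 r1; have [c [c0 /(_ r)]] := a_bounds (r / 2) (divr_gt0 r0 (ltr0n _ 2)).
  case; [lra|by []|].
  case: (a r) => [s| |] //=; last by rewrite invey lee_fin => _; rewrite leNgt c0.
  by rewrite lee_fin => cs _; split => //; exact: lt_le_trans cs.
(* [a] is finite and positive on [0 < r < 1], so the power [-1] is its inverse; as
   a power function it is known to be measurable. *)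
pose q : R -> R := (fun r => (fine (a r)) `^ (-1)) \_ (`]0, 1[%classic : set (measurableTypeR R)).
have qE r : q r = if 0 < r < 1 then (fine (a r))^-1 else 0.
  rewrite /q patchE; case: (ifPn (0 < r < 1)) => [/andP[r0 r1]|r01].
    rewrite mem_set; last by rewrite /= in_itv/= r0 r1.
    by rewrite powR_inv1 ?ltW//; have [] := aE r r0 (ltW r1).
  by rewrite memNset//= in_itv/=; exact/negP.
have q1 r : 0 < r < 1 -> 0 < q r.
  move=> /[dup] r01 /andP[r0 r1]; rewrite qE r01 invr_gt0.
  by have [] := aE r r0 (ltW r1).
have q0 r : 0 <= q r by case: (boolP (0 < r < 1)) => [/q1/ltW//|r01]; rewrite qE (negbTE r01).
have mI : measurable (`]0, 1[%classic : set (measurableTypeR R)) by exact: measurable_itv.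
have mq : measurable_fun [set: measurableTypeR R] q.
  apply/(measurable_restrictT _ mI); apply: (measurableT_comp (measurable_powR _)).
  have mf : measurable_fun [set: \bar R] fine by [].
  apply: (measurableT_comp mf).
  apply: measurable_funS a_meas => //.
  by move=> r /=; rewrite !in_itv/= => /andP[-> /ltW].
have aVE r : 0 < r < 1 -> ((a r)^-1)%E = (q r)%:E.
  move=> /[dup] r01 /andP[r0 r1]; have [-> ap] := aE r r0 (ltW r1).
  by rewrite qE r01 inver gt_eqF.
pose s := (\int[@lebesgue_measure R]_(r in `]0%R, 1%R[) ((q r)^-1 / r)%:E)%E.
have s_oo : (s < +oo)%E.
  apply: le_lt_trans a_int; apply: ge0_integral_mono.
  - by move=> r /=; rewrite !in_itv/= => /andP[-> /ltW].
  - by move=> r /=; rewrite in_itv/= => /andP[r0 _]; rewrite lee_fin divr_ge0 ?invr_ge0// ltW.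
  - move=> r /=; rewrite in_itv/= => /andP[r0 r1].
    by rewrite mule_ge0 ?a_ge0// lee_fin invr_ge0 ltW.
  - move=> r /=; rewrite in_itv/= => /[dup] r01 /andP[r0 r1].
    have [-> ap] := aE r r0 (ltW r1).
    by rewrite -EFinM lee_fin qE r01 invrK.
have s0 : (0 <= s)%E.
  apply: integral_ge0 => r /=; rewrite in_itv/= => /andP[r0 _].
  by rewrite lee_fin divr_ge0 ?invr_ge0// ltW.
(* The summand 1 makes the bound [S] strictly positive. *)
pose S := fine s + 1.
have S0 : 0 < S by rewrite ltr_wpDl// fine_ge0.
have HS : (s <= S%:E)%E by rewrite EFinD fineK ?ge0_fin_numE// leeDl.
have half0 : 0 < 2^-1 :> R by rewrite invr_gt0 ltr0n.
have [c [c0 Hc]] := a_bounds 2^-1 half0.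
have cV0 : 0 < c^-1 by rewrite invr_gt0.
have HC r : 2^-1 < r < 1 -> 1 <= c^-1 * q r.
  move=> /andP[r2 r1]; have [_] := Hc r r2 (ltW r1).
  rewrite aVE ?r1 ?andbT; last by lra.
  by rewrite lee_fin ler_pdivlMl// mulr1.
have Hm : (\int[@lebesgue_measure R]_(r in `]0%R, 1%R[) (r * q r)%:E < +oo)%E.
  apply: le_lt_trans ainv_int; apply: ge0_integral_mono.
  - by move=> r /=; rewrite !in_itv/= => /andP[-> /ltW].
  - by move=> r /=; rewrite in_itv/= => /andP[r0 _]; rewrite lee_fin mulr_ge0// ltW.
  - move=> r /=; rewrite in_itv/= => /andP[r0 r1].
    by rewrite mule_ge0 ?inve_ge0 ?a_ge0// lee_fin ltW.
  - by move=> r /=; rewrite in_itv/= => r01; rewrite aVE// EFinM.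
have enorm0 (x : R * R) : x.2 != 0 -> 0 < enorm x.
  move=> x2; rewrite sqrtr_gt0 ltr_wpDl ?sqr_ge0// lt_neqAle sqr_ge0 andbT.
  by rewrite eq_sym expf_eq0.
have rho0 x : (0 <= weight a x)%E.
  rewrite /weight; case: ifPn => [|_].
    rewrite inE => -[Qx]; rewrite /unit_disc/= => x1; rewrite inve_ge0 a_ge0 ?ltW// enorm0//.
    by case: Qx => -[_]; [move/gt_eqF->|move/lt_eqF->].
  case: ifPn => //; rewrite inE => -[Qx]; rewrite /unit_disc/= => x1; rewrite a_ge0 ?ltW// enorm0//.
  by case: Qx => -[_]; [move/gt_eqF->|move/lt_eqF->].
have qrho x : sector x -> ((q (enorm x))%:E <= weight a x)%E.
  move=> /andP[x2 x12].
  have x0 : 0 < enorm x by rewrite enorm0// gt_eqF.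
  have [x1|x1] := ltP (enorm x) 1.
    rewrite /weight mem_set; last by split => //; left; split => //; exact: lt_trans x12.
    by rewrite aVE// x0.
  by rewrite qE x0 ltNge x1/=; exact: rho0.
apply: (@lt_le_trans _ _ ((16 * (8 * c^-1 + 2 * S))^-1)%:E).
  rewrite lte_fin invr_gt0; lra.
apply: le_ereal_inf_tmp => _ [A [oA A0] <-].
apply: le_ereal_inf_tmp => _ [u [g [Hug neg ->]]].
by apply: (energy1_ge mq q0 q1 S0 HS cV0 HC Hm rho0 qrho oA _ Hug neg); exact: A0.
Qed.
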